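(* Let $\mathbb A\subseteq\{2,3,4,\ldots\}$ be a finite non-empty set, ordered by the usual order $2<3<4<\cdots$. Let $\mathcal C$ be a cyclic Abelian class over $\mathbb A$ and let $\omega\in\mathcal C$. (1) If $K^{\circlearrowright}(\omega)=\min\{K^{\circlearrowright}(\nu):\nu\in\mathcal C\}$, then $\omega\in\mathcal S_{alt}(\mathcal C)$. (2) If $K^{\circlearrowright}(\omega)=\max\{K^{\circlearrowright}(\nu):\nu\in\mathcal C\}$, then $\omega\in\mathcal U_{alt}(\mathcal C)$. (3) If $\dot K^{\circlearrowright}(\omega)=\min\{\dot K^{\circlearrowright}(\nu):\nu\in\mathcal C\}$, then $\omega\in\mathcal U(\mathcal C)$. (4) If $\dot K^{\circlearrowright}(\omega)=\max\{\dot K^{\circlearrowright}(\nu):\nu\in\mathcal C\}$, then $\omega\in\mathcal S(\mathcal C)$.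
   Context: Words: $\mathbb A^+$ (resp. $\mathbb A^*$) is the set of non-empty (resp. all) finite words over $\mathbb A$. For $x=x_1\cdots x_n$ put $x^*=x_n\cdots x_1$. A cyclic word over $\mathbb A$ is an equivalence class of $\mathbb A^+$ under $w\sim w'$ iff $w=pq$, $w'=qp$ for some $p,q\in\mathbb A^*$; $\mathbb A^\circlearrowright$ is the set of cyclic words. ''$\omega=uv$'' means that $uv$ is a linear representation of (i.e. belongs to the class) $\omega$. A cyclic Abelian class is the set of all cyclic words over $\mathbb A$ having a prescribed non-zero Parikh vector $(|\omega|_a)_{a\in\mathbb A}$, where $|\omega|_a$ is the number of occurrences of the letter $a$. Orders (for words of equal length): if $x\ne y$ have equal length and $i$ is the first (1-based) index with $x_i\neq y_i$, then $x\prec y$ iff $x_i<y_i$; and $x\prec_{alt}y$ iff ($i$ odd and $x_i<y_i$) or ($i$ even and $x_i>y_i$). Factorizations $\omega=uv$ are always understood with $u,v\in\mathbb A^+$, $u\ne u^*$, $v\ne v^*$. Such a factorization is synchronizing if ($u\prec u^*\iff v\prec v^*$), and alt-synchronizing if ($u\prec_{alt}u^*\iff v\prec_{alt}v^*$). $\mathcal S(\mathcal C)$ (resp. $\mathcal S_{alt}(\mathcal C)$) is the set of $\omega\in\mathcal C$ all of whose factorizations $\omega=uv$ are synchronizing (resp. alt-synchronizing). $\mathcal U(\mathcal C)$ (resp. $\mathcal U_{alt}(\mathcal C)$) is the set of $\omega\in\mathcal C$ having no synchronizing (resp. alt-synchronizing) factorization. Continuants: $K()=1$, $K(x_1)=x_1$,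 $K(x_1\cdots x_n)=x_nK(x_1\cdots x_{n-1})+K(x_1\cdots x_{n-2})$; $\dot K()=1$, $\dot K(x_1)=x_1$, $\dot K(x_1\cdots x_n)=x_n\dot K(x_1\cdots x_{n-1})-\dot K(x_1\cdots x_{n-2})$. Cyclic versions: $K^{\circlearrowright}(x_1\cdots x_n)=K(x_1\cdots x_n)+K(x_2\cdots x_{n-1})$ and $\dot K^{\circlearrowright}(x_1\cdots x_n)=\dot K(x_1\cdots x_n)-\dot K(x_2\cdots x_{n-1})$ for $n\ge2$ (for $n=1$ both are taken to be $x_1$). They are invariant under cyclic conjugation, hence well defined on cyclic words. *)

(* Defs.v *)
From HB Require Import structures.
From mathcomp Require Import all_boot all_order all_algebra generic_quotient.
From mathcomp Require Import boolp classical_sets cardinality.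
From mathcomp Require Import ring zify.
Set Implicit Arguments.
Unset Strict Implicit.
Unset Printing Implicit Defensive.
Import Order.TTheory GRing.Theory Num.Theory.
Local Open Scope classical_set_scope.
Local Open Scope quotient_scope.

(* Letters are natural numbers; an alphabet is a set [A : set nat]. Conjugation
   does not change the letters of a word, so the cyclic words over [A] are the
   cyclic words over [nat] having a representative with letters in [A]. *)

Definition word : Type := seq nat.

Definition word_plus (A : set nat) : set word :=
  [set w | w <> [::] /\ forall a, a \in w -> A a].

Definition conj_word (w w' : word) : bool :=
  [exists i : 'I_(size w).+1, w' == rot i w].

Lemma conj_wordP (w w' : word) :
  reflect (exists p q : word, w = p ++ q /\ w' = q ++ p) (conj_word w w').
Proof.
apply: (iffP existsP) => [[i /eqP ->]|[p [q [-> ->]]]].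
  by exists (take i w), (drop i w); rewrite cat_take_drop.
have lp : (size p < (size (p ++ q)).+1)%N by rewrite ltnS size_cat leq_addr.
by exists (Ordinal lp); rewrite /= rot_size_cat.
Qed.

Lemma conj_word_refl : reflexive conj_word.
Proof. by move=> w; apply/conj_wordP; exists [::], w; rewrite cats0. Qed.

Lemma conj_word_sym : symmetric conj_word.
Proof.
by move=> w w'; apply/conj_wordP/conj_wordP => -[p [q [-> ->]]]; exists q, p.
Qed.

Lemma conj_word_trans : transitive conj_word.
Proof.
move=> y x z /existsP[i /eqP ->] /existsP[j /eqP ->].
have li : (i <= size x)%N := leq_ord i.
have lj : (j <= size x)%N by rewrite (leq_trans (leq_ord j)) // size_rot.
rewrite rot_add_mod //; set k := (if _ then _ else _).
have lk : (k < (size x).+1)%N by rewrite /k; case: ifP; lia.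
by apply/existsP; exists (Ordinal lk).
Qed.

Definition nword : Type := {w : word | w != [::]}.
HB.instance Definition _ := Choice.on nword.

Definition conj_nword (w w' : nword) : bool := conj_word (val w) (val w').

Lemma conj_nword_equiv : equiv_class_of conj_nword.
Proof.
split=> [w|w w'|w' w w''].
- exact: conj_word_refl.
- exact: conj_word_sym.
- exact: conj_word_trans.
Qed.

Canonical conj_nword_rel := EquivRelPack conj_nword_equiv.

Definition cword : Type := {eq_quot conj_nword}.
HB.instance Definition _ := Choice.on cword.
HB.instance Definition _ := EqQuotient.on cword.

Definition linear_rep (om : cword) (w : word) : Prop :=
  exists w' : nword, val w' = w /\ \pi_cword w' = om.

Definition cword_repr (om : cword) : word := val (repr om).

Lemma linear_repP (om : cword) (w : word) :
  linear_rep om w <-> conj_word (cword_repr om) w.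
Proof.
split=> [[w' [<- <-]]|c].
  rewrite conj_word_sym /cword_repr -[conj_word _ _]/(conj_nword w' _).
  by apply/eqmodP; rewrite reprK.
have w0 : w != [::].
  by case/existsP: c => i /eqP ->; rewrite -size_eq0 size_rot size_eq0 (valP (repr om)).
exists (exist _ w w0); split=> //; rewrite -[om in RHS]reprK.
by apply/eqmodP; rewrite /= /conj_nword /= conj_word_sym.
Qed.

Definition cyclic_words (A : set nat) : set cword :=
  [set om | exists2 w, word_plus A w & linear_rep om w].

Definition parikh (om : cword) (a : nat) : nat := count_mem a (cword_repr om).

Lemma parikhE (om : cword) (w : word) (a : nat) :
  linear_rep om w -> parikh om a = count_mem a w.
Proof.
move=> /linear_repP /existsP[i /eqP ->].
by rewrite /parikh; apply/esym/permP; rewrite perm_rot.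
Qed.

Definition cyclic_abelian_class (A : set nat) (C : set cword) : Prop :=
  exists2 p : nat -> nat, (exists2 a, A a & p a <> 0%N) &
    C = [set om | cyclic_words A om /\ forall a, A a -> parikh om a = p a].

Definition first_diff (x y : word) : nat :=
  find (fun ab => ab.1 != ab.2) (zip x y).

(* If [x = y] the index is [size x], both letters read are the default [0],
   and both relations are false. *)
Definition prec (x y : word) : bool :=
  let i := first_diff x y in (nth 0 x i < nth 0 y i)%N.

(* [first_diff] counts from 0, so an odd 1-based index is an even [i] here. *)
Definition prec_alt (x y : word) : bool :=
  let i := first_diff x y in
  if odd i then (nth 0 y i < nth 0 x i)%N else (nth 0 x i < nth 0 y i)%N.

Definition factorization (A : set nat) (om : cword) (u v : word) : Prop :=
  [/\ word_plus A u, word_plus A v, u <> rev u, v <> rev v &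
      linear_rep om (u ++ v)].

Definition synchronizing (u v : word) : Prop :=
  prec u (rev u) <-> prec v (rev v).

Definition alt_synchronizing (u v : word) : Prop :=
  prec_alt u (rev u) <-> prec_alt v (rev v).

Definition S_set (A : set nat) (C : set cword) : set cword :=
  [set om | C om /\ forall u v, factorization A om u v -> synchronizing u v].

Definition S_alt_set (A : set nat) (C : set cword) : set cword :=
  [set om | C om /\ forall u v, factorization A om u v -> alt_synchronizing u v].

Definition U_set (A : set nat) (C : set cword) : set cword :=
  [set om | C om /\ ~ exists u v, factorization A om u v /\ synchronizing u v].

Definition U_alt_set (A : set nat) (C : set cword) : set cword :=
  [set om | C om /\ ~ exists u v, factorization A om u v /\ alt_synchronizing u v].

Local Open Scope ring_scope.

(* The two continuants differ only by the sign [e] of the last term of the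
   recurrence. That recurrence peels letters off the right end of the word, so
   the structural recursion runs on the reversed word. *)
Fixpoint continuant_rev (e : int) (s : word) : int :=
  match s with
  | [::] => 1
  | x :: s1 =>
    match s1 with
    | [::] => x%:Z
    | _ :: s2 => x%:Z * continuant_rev e s1 + e * continuant_rev e s2
    end
  end.

Definition continuant (e : int) (w : word) : int := continuant_rev e (rev w).

Definition cyclic_continuant (e : int) (w : word) : int :=
  match w with
  | [::] => 0 (* junk value: cyclic words are non-empty *)
  | [:: x] => x%:Z
  | _ :: y :: s => continuant e w + e * continuant e (belast y s)
  end.

Definition K : word -> int := continuant 1.
Definition Kdot : word -> int := continuant (-1).

Definition Kcyc_word : word -> int := cyclic_continuant 1.
Definition Kdotcyc_word : word -> int := cyclic_continuant (-1).

Definition Kcyc (om : cword) : int := Kcyc_word (cword_repr om).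
Definition Kdotcyc (om : cword) : int := Kdotcyc_word (cword_repr om).

Lemma K_nil : K [::] = 1. Proof. by []. Qed.
Lemma Kdot_nil : Kdot [::] = 1. Proof. by []. Qed.
Lemma K_seq1 x : K [:: x] = x%:Z. Proof. by []. Qed.
Lemma Kdot_seq1 x : Kdot [:: x] = x%:Z. Proof. by []. Qed.

Lemma continuant_rcons e w y x :
  continuant e (rcons (rcons w y) x) =
  x%:Z * continuant e (rcons w y) + e * continuant e w.
Proof. by rewrite /continuant !rev_rcons. Qed.

Lemma K_rcons w y x :
  K (rcons (rcons w y) x) = x%:Z * K (rcons w y) + K w.
Proof. by rewrite /K continuant_rcons mul1r. Qed.

Lemma Kdot_rcons w y x :
  Kdot (rcons (rcons w y) x) = x%:Z * Kdot (rcons w y) - Kdot w.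
Proof. by rewrite /Kdot continuant_rcons mulN1r. Qed.

Lemma Kcyc_wordE x w y :
  Kcyc_word (x :: rcons w y) = K (x :: rcons w y) + K w.
Proof.
by case: w => [|z w]; rewrite /Kcyc_word /K /= mul1r // belast_rcons.
Qed.

Lemma Kdotcyc_wordE x w y :
  Kdotcyc_word (x :: rcons w y) = Kdot (x :: rcons w y) - Kdot w.
Proof.
by case: w => [|z w]; rewrite /Kdotcyc_word /Kdot /= mulN1r // belast_rcons.
Qed.

Lemma continuant_cons e x y w :
  continuant e [:: x, y & w] =
  x%:Z * continuant e (y :: w) + e * continuant e w.
Proof.
have [n] := ubnP (size w); elim: n => // n IHn in w *.
case/lastP: w => [|w a]; first by move=> _; rewrite /continuant /=; ring.
case/lastP: w => [|w b]; first by move=> _; rewrite /continuant /=; ring.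
rewrite !size_rcons !ltnS => lt_n.
have H1 := IHn (rcons w b); rewrite size_rcons in H1.
have H2 := IHn w.
rewrite -!rcons_cons !continuant_rcons !rcons_cons.
rewrite H1 ?H2 //; first by ring.
exact: ltnW.
Qed.

Lemma cyclic_continuant_rot1 e x s :
  cyclic_continuant e (rcons s x) = cyclic_continuant e (x :: s).
Proof.
case: s => [//|y s].
have -> : cyclic_continuant e (rcons (y :: s) x) =
    continuant e (rcons (y :: s) x) + e * continuant e s.
  by case: s => [|z s] //=; rewrite belast_rcons.
rewrite [RHS]/= continuant_cons (lastI y s) continuant_rcons.
by ring.
Qed.

Lemma cyclic_continuant_conj e w w' :
  conj_word w w' -> cyclic_continuant e w = cyclic_continuant e w'.
Proof.
move=> /conj_wordP[p [q [-> ->]]].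
elim: p q => [|x p IHp] q; first by rewrite cats0.
by rewrite -cat_rcons -IHp cat_cons -cyclic_continuant_rot1 rcons_cat.
Qed.

Lemma KcycE om w : linear_rep om w -> Kcyc om = Kcyc_word w.
Proof. by move=> /linear_repP /cyclic_continuant_conj; apply. Qed.

Lemma KdotcycE om w : linear_rep om w -> Kdotcyc om = Kdotcyc_word w.
Proof. by move=> /linear_repP /cyclic_continuant_conj; apply. Qed.

Definition is_min (X : set int) (m : int) : Prop := X m /\ lbound X m.
Definition is_max (X : set int) (m : int) : Prop := X m /\ ubound X m.

(* Main.v *)
(** Replacing a factorization [u ++ v] by [rev u ++ v] stays in the cyclic
    Abelian class and changes the cyclic continuant by
    [- e * end_gap e u * end_gap e v], where [end_gap e u] is the difference of
    the continuants of [u] without its last and without its first letter.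
    Stripping a common outer letter multiplies [end_gap] by [- e]; once the outer
    letters differ, their comparison decides its sign, because all letters are at
    least 2. So for [e = 1] (resp. [e = -1]) the sign of [end_gap] tells whether
    [u] precedes [rev u] in the alternating (resp. lexicographic) order, and
    extremality forces the signs for [u] and [v] to agree, or to disagree. *)
Require Import Defs.
From mathcomp Require Import all_boot all_order all_algebra.
From mathcomp Require Import classical_sets cardinality.
From mathcomp Require Import generic_quotient ring zify.
Import Order.TTheory GRing.Theory Num.Theory.
Local Open Scope classical_set_scope.

Set Implicit Arguments.
Unset Strict Implicit.

(** * Continuant identities and the end gap *)

Section EndGap.
Local Open Scope ring_scope.
Implicit Types (e : int) (u v w : word) (x y : nat).

(** The hypothesis on [rev w] serves the alternating order, where stripping a common first letter
    swaps the two words compared. *)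
Lemma word_ends_ind (P : word -> Prop) :
  P [::] -> (forall x, P [:: x]) ->
  (forall x w y, P w -> P (rev w) -> P (x :: rcons w y)) -> forall w, P w.
Proof.
move=> P0 P1 P2 w; have [n] := ubnP (size w); elim: n w => // n IHn [//|x w].
case/lastP: w => // w y; rewrite /= size_rcons => lt_n.
by apply: P2; apply: IHn; rewrite ?size_rev; lia.
Qed.

Lemma rev_ends x w y : rev (x :: rcons w y) = y :: rcons (rev w) x.
Proof. by rewrite rev_cons rev_rcons. Qed.

Lemma continuant_rev_word e w : continuant e (rev w) = continuant e w.
Proof.
rewrite {1}/continuant revK.
have [n] := ubnP (size w); elim: n w => // n IHn [|x [|y w]] // lt_n.
rewrite continuant_cons -IHn -?[continuant e w]IHn //.
by move: lt_n => /=; lia.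
Qed.

(** Euler's identity for splitting a continuant between the adjacent letters [x] and [y]. *)
Lemma continuant_cat e p x y q :
  continuant e (rcons p x ++ y :: q) =
  continuant e (rcons p x) * continuant e (y :: q)
  + e * continuant e p * continuant e q.
Proof.
have [n] := ubnP (size p); elim: n p => // n IHn [|a [|b p]] lt_n.
- by rewrite /= continuant_cons /continuant /=; ring.
- by rewrite /= !continuant_cons /continuant /=; ring.
rewrite !rcons_cons !cat_cons !continuant_cons.
rewrite -cat_cons -rcons_cons !IHn; first by rewrite rcons_cons; ring.
  by move: lt_n => /=; lia.
by move: lt_n => /=; lia.
Qed.

Lemma cyclic_continuant_ends e x w y :
  cyclic_continuant e (x :: rcons w y) =
  continuant e (x :: rcons w y) + e * continuant e w.
Proof. by case: w => [|z w] //=; rewrite belast_rcons. Qed.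

Definition end_gap e u : int :=
  if u is x :: s then continuant e (belast x s) - continuant e s else 0.

Lemma end_gap_ends e x w y :
  end_gap e (x :: rcons w y) = continuant e (x :: w) - continuant e (rcons w y).
Proof. by rewrite /= belast_rcons. Qed.

Lemma end_gap_rev e u : end_gap e (rev u) = - end_gap e u.
Proof.
case: u => [|x w]; first by rewrite oppr0.
case/lastP: w => [|w y]; first by rewrite /= subrr.
rewrite rev_ends !end_gap_ends -rev_rcons -rev_cons !continuant_rev_word.
by rewrite opprB.
Qed.

(** Expand one continuant at its first letter [x], the other at its last letter [y]; what remains is
    the gap of [w] with its two terms exchanged. *)
Lemma end_gap_recur e x w y :
  end_gap e (x :: rcons w y) =
  (x%:Z - y%:Z) * continuant e w - e * end_gap e w.
Proof.
rewrite end_gap_ends; case: w => [|z w]; first by rewrite /continuant /=; ring.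
by rewrite continuant_cons (lastI z w) continuant_rcons -lastI /=; ring.
Qed.

Lemma palindrome_or_ends u :
  u = rev u \/ exists x w y, u = x :: rcons w y.
Proof.
case: u => [|x w]; first by left.
by case/lastP: w => [|w y]; [left | right; exists x, w, y].
Qed.

Lemma cyclic_continuant_rev_factor e u v :
  u <> rev u -> v <> rev v ->
  cyclic_continuant e (u ++ v) - cyclic_continuant e (rev u ++ v) =
  - e * end_gap e u * end_gap e v.
Proof.
have [|[x [w [y ->]]]] := palindrome_or_ends u; first by [].
have [|[z [t [s ->]]]] := palindrome_or_ends v; first by [].
move=> _ _; rewrite rev_ends.
(* Both continuants in the cyclic one are split at the junction of the two factors. Reversing the
   first factor only exchanges the continuants of [x' :: w'] and [rcons w' y']. *)
have cycE x' w' y' : cyclic_continuant e ((x' :: rcons w' y') ++ z :: rcons t s)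
    = continuant e (x' :: rcons w' y') * continuant e (z :: rcons t s)
      + e * continuant e (x' :: w') * continuant e (rcons t s)
      + e * (continuant e (rcons w' y') * continuant e (z :: t)
             + e * continuant e w' * continuant e t).
  rewrite cat_cons -rcons_cons -rcons_cat cyclic_continuant_ends.
  by rewrite rcons_cat -cat_cons -rcons_cons !continuant_cat.
rewrite !cycE !end_gap_ends -rev_rcons -rev_ends -rev_cons.
by rewrite !continuant_rev_word; ring.
Qed.

(** * Size and sign estimates for letters at least 2 *)

Section LettersGe2.
Variable e : int.
Hypothesis e1 : e = 1 \/ e = -1.

(** Positivity and growth are proved together: for [e = -1], twice the continuant of the tail minus
    a strictly smaller one still exceeds that of the tail. *)
Lemma continuant_gt_behead x w : all (leq 2) (x :: w) ->
  0 < continuant e w < continuant e (x :: w).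
Proof.
elim: w x => [|y w IHw] x; first by rewrite /continuant /= andbT => x2; lia.
move=> /= /andP[x2 yw2]; have /andP[] := IHw y yw2.
by rewrite continuant_cons; case: e1 => ->; nia.
Qed.

Lemma continuant_gt0 w : all (leq 2) w -> 0 < continuant e w.
Proof.
by case: w => [//|x w] /continuant_gt_behead /andP[]; apply: lt_trans.
Qed.

(** Off palindromes, the gap is a difference of two numbers strictly between 0 and the continuant of
    [w]. *)
Lemma end_gap_bound w : all (leq 2) w -> `|end_gap e w| < continuant e w.
Proof.
have [|[x [t [y ->]]]] := palindrome_or_ends w => [pal|].
  have g0 : end_gap e w = 0 by have := end_gap_rev e w; rewrite -pal; lia.
  by rewrite g0 normr0 => /continuant_gt0.
rewrite end_gap_ends => w2; have /andP[] := continuant_gt_behead w2.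
have : all (leq 2) (y :: rev (x :: t)).
  by rewrite -rev_rcons all_rev rcons_cons.
move=> /continuant_gt_behead; rewrite -rev_rcons !continuant_rev_word.
by rewrite rcons_cons; lia.
Qed.

(** In [end_gap_recur] the term with [x - y] has absolute value at least the continuant of [w], so
    it outweighs the gap of [w]. *)
Lemma end_gap_neq_ends x w y : all (leq 2) w -> x <> y ->
  (end_gap e (x :: rcons w y) < 0) = (x < y)%N /\
  end_gap e (x :: rcons w y) <> 0.
Proof.
move=> /end_gap_bound; rewrite end_gap_recur.
by case: e1 => ->; case: (ltngtP x y) => // lt_xy; nia.
Qed.

End LettersGe2.

Lemma all_ends (a : pred nat) x w y : all a (x :: rcons w y) -> all a w.
Proof. by rewrite /= all_rcons => /and3P[]. Qed.

(** * First differences and the two orders *)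

Lemma first_diff_cons x u y v :
  first_diff (x :: u) (y :: v) = if x == y then (first_diff u v).+1 else 0%N.
Proof. by rewrite /first_diff /=; case: (x == y). Qed.

Lemma first_diff_rcons u v x y : size u = size v -> u <> v ->
  first_diff (rcons u x) (rcons v y) = first_diff u v.
Proof.
elim: u v => [|a u IHu] [|b v] //= [szuv] neq.
rewrite !first_diff_cons; case: eqP => // ab.
by rewrite IHu // => uv; apply: neq; rewrite ab uv.
Qed.

Lemma first_diffC u v : first_diff u v = first_diff v u.
Proof.
elim: u v => [|a u IHu] [|b v] //.
by rewrite !first_diff_cons eq_sym IHu.
Qed.

Lemma first_diff_lt u v : size u = size v -> u <> v ->
  (first_diff u v < size u)%N.
Proof.
elim: u v => [|a u IHu] [|b v] //= [szuv] neq.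
rewrite first_diff_cons; case: eqP => // ab.
by rewrite ltnS IHu // => uv; apply: neq; rewrite ab uv.
Qed.

Lemma prec_cons x u y v :
  prec (x :: u) (y :: v) = if x == y then prec u v else (x < y)%N.
Proof. by rewrite /prec first_diff_cons; case: eqP. Qed.

(** Dropping a common letter shifts the parity of every position, hence the swapped arguments. *)
Lemma prec_alt_cons x u y v :
  prec_alt (x :: u) (y :: v) = if x == y then prec_alt v u else (x < y)%N.
Proof.
rewrite /prec_alt first_diff_cons (first_diffC v); case: eqP => //= _.
by case: (odd _).
Qed.

Lemma prec_rcons u v x y : size u = size v -> u <> v ->
  prec (rcons u x) (rcons v y) = prec u v.
Proof.
move=> szuv neq; have lt := first_diff_lt szuv neq.
by rewrite /prec first_diff_rcons // !nth_rcons -szuv lt.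
Qed.

Lemma prec_alt_rcons u v x y : size u = size v -> u <> v ->
  prec_alt (rcons u x) (rcons v y) = prec_alt u v.
Proof.
move=> szuv neq; have lt := first_diff_lt szuv neq.
by rewrite /prec_alt first_diff_rcons // !nth_rcons -szuv lt.
Qed.

Lemma end_gap_prec u : all (leq 2) u -> u <> rev u ->
  (end_gap (-1) u < 0) = prec u (rev u) /\ end_gap (-1) u <> 0.
Proof.
elim/word_ends_ind: u => // x w y IHw _ u2 npal; have w2 := all_ends u2.
rewrite rev_ends prec_cons; case: eqP => [xy|]; last first.
  by apply: end_gap_neq_ends => //; right.
have npalw : w <> rev w by move=> pal; apply: npal; rewrite rev_ends xy -pal.
rewrite prec_rcons ?size_rev // end_gap_recur xy.
have [<- neq0] := IHw w2 npalw.
by rewrite subrr mul0r sub0r mulN1r opprK.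
Qed.

Lemma end_gap_prec_alt u : all (leq 2) u -> u <> rev u ->
  (end_gap 1 u < 0) = prec_alt u (rev u) /\ end_gap 1 u <> 0.
Proof.
elim/word_ends_ind: u => // x w y _ IHw u2 npal; have w2 := all_ends u2.
rewrite rev_ends prec_alt_cons; case: eqP => [xy|]; last first.
  by apply: end_gap_neq_ends => //; left.
have npalw : rev w <> w by move=> pal; apply: npal; rewrite rev_ends xy pal.
rewrite prec_alt_rcons ?size_rev // end_gap_recur xy.
(* The induction hypothesis is the one for [rev w]: its gap is minus that of [w], matching both the
   factor [- e = -1] and the swapped comparison. *)
rewrite all_rev revK end_gap_rev in IHw; have [<- neq0] := IHw w2 npalw.
by rewrite subrr mul0r sub0r mul1r.
Qed.

End EndGap.

(** * Exchange of a factor for its reversal within the class *)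

Lemma factorization_rev_class (A : set nat) (C : set cword) (om : cword)
    (u v : word) : cyclic_abelian_class A C -> C om -> factorization A om u v ->
  exists2 nu, C nu & linear_rep nu (rev u ++ v).
Proof.
move=> [p _ ->] [_ omp] [[u0 uA] [_ vA] _ _ repuv].
have w0 : rev u ++ v != [::].
  by case: u u0 {uA repuv} => // x u _; rewrite rev_cons cat_rcons; case: (rev u).
pose nw : nword := exist _ (rev u ++ v) w0.
have repnu : linear_rep (\pi_cword nw)%qT (rev u ++ v) by exists nw.
exists (\pi_cword nw)%qT => //; split=> [|a Aa].
  exists (rev u ++ v) => //; split=> [|a]; first exact/eqP.
  by rewrite mem_cat mem_rev => /orP[/uA|/vA].
rewrite (parikhE _ repnu) -(omp a Aa) (parikhE _ repuv) !count_cat.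
by rewrite count_rev.
Qed.

Lemma word_plus_ge2 (A : set nat) (w : word) :
  (forall a, A a -> 2 <= a)%N -> word_plus A w -> all (leq 2) w.
Proof. by move=> A2 [_ wA]; apply/allP => a /wA /A2. Qed.

Section Exchange.
Local Open Scope ring_scope.
Variables (A : set nat) (C : set cword) (om : cword) (u v : word).
Hypotheses (A_ge2 : forall a, A a -> (2 <= a)%N).
Hypotheses (hC : cyclic_abelian_class A C) (hom : C om).
Hypothesis fuv : factorization A om u v.

Lemma Kcyc_exchange : exists2 nu, C nu &
  (alt_synchronizing u v -> Kcyc om < Kcyc nu) /\
  (~ alt_synchronizing u v -> Kcyc nu < Kcyc om).
Proof.
have [nu Cnu repnu] := factorization_rev_class hC hom fuv; exists nu => //.
case: fuv => /(word_plus_ge2 A_ge2) u2 /(word_plus_ge2 A_ge2) v2 uN vN rep.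
rewrite /alt_synchronizing (KcycE rep) (KcycE repnu) /Kcyc_word.
have [<- ?] := end_gap_prec_alt u2 uN; have [<- ?] := end_gap_prec_alt v2 vN.
by have := cyclic_continuant_rev_factor 1 uN vN; split=> sync; nia.
Qed.

(** For [e = -1] the change is plus the product of the gaps, so the inequalities are opposite to
    those of [Kcyc_exchange]. *)
Lemma Kdotcyc_exchange : exists2 nu, C nu &
  (synchronizing u v -> Kdotcyc nu < Kdotcyc om) /\
  (~ synchronizing u v -> Kdotcyc om < Kdotcyc nu).
Proof.
have [nu Cnu repnu] := factorization_rev_class hC hom fuv; exists nu => //.
case: fuv => /(word_plus_ge2 A_ge2) u2 /(word_plus_ge2 A_ge2) v2 uN vN rep.
rewrite /synchronizing (KdotcycE rep) (KdotcycE repnu) /Kdotcyc_word.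
have [<- ?] := end_gap_prec u2 uN; have [<- ?] := end_gap_prec v2 vN.
by have := cyclic_continuant_rev_factor (-1) uN vN; split=> sync; nia.
Qed.

End Exchange.

Unset Implicit Arguments.
Set Strict Implicit.

Theorem proposition3p2 (A : set nat) (finA : finite_set A) (A0 : A !=set0)
    (A_ge2 : forall a, A a -> (2 <= a)%N)
    (C : set cword) (hC : cyclic_abelian_class A C)
    (om : cword) (hom : C om) :
  (is_min [set Kcyc nu | nu in C] (Kcyc om) -> S_alt_set A C om) /\
  (is_max [set Kcyc nu | nu in C] (Kcyc om) -> U_alt_set A C om) /\
  (is_min [set Kdotcyc nu | nu in C] (Kdotcyc om) -> U_set A C om) /\
  (is_max [set Kdotcyc nu | nu in C] (Kdotcyc om) -> S_set A C om).
Proof.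
split; [|split; [|split]] => -[_ ext]; split=> //.
(* A factorization that is not alt-synchronizing would give a strictly smaller value in the
   class. *)
- move=> u v fuv; have [nu Cnu [_ lt]] := Kcyc_exchange A_ge2 hC hom fuv.
  apply: boolp.contrapT => /lt; apply/negP; rewrite -leNgt.
  by apply: ext; exists nu.
- move=> [u [v [fuv sync]]].
  have [nu Cnu [/(_ sync) + _]] := Kcyc_exchange A_ge2 hC hom fuv.
  by apply/negP; rewrite -leNgt; apply: ext; exists nu.
- move=> [u [v [fuv sync]]].
  have [nu Cnu [/(_ sync) + _]] := Kdotcyc_exchange A_ge2 hC hom fuv.
  by apply/negP; rewrite -leNgt; apply: ext; exists nu.
- move=> u v fuv; have [nu Cnu [_ lt]] := Kdotcyc_exchange A_ge2 hC hom fuv.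
  apply: boolp.contrapT => /lt; apply/negP; rewrite -leNgt.
  by apply: ext; exists nu.
Qed.
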